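(* Let $m\ge0$ be an integer. For all $0<r<1/3$, and for generic $r$ with $1/3<r<1$ (i.e. for all $r\in(1/3,1)$ outside a set of isolated exceptional values having no accumulation point in $(1/3,1)$), the caustic of $R_r^{2m+1}$ has cusps at $\phi=0$ and at $\phi=\pi$.
   Context: Points of the unit circle $S^1\subset\mathbb{R}^2$ are written as $\phi \bmod 2\pi$, standing for $(\cos\phi,\sin\phi)$. For $0\le r<1$ the off-center reflection $R_r:S^1\to S^1$ is defined as follows: emit a ray from $(r,0)$ to $z\in S^1$, reflect it at $z$ in the circle (mirror reflection), and let $R_r(z)$ be the other point where the reflected ray meets $S^1$. Analytically, $R_r(\phi)=\phi+\pi-2\alpha(\phi) \pmod{2\pi}$ with $\alpha(\phi)=\operatorname{Arg}(\cos\phi-r+i\sin\phi)-\phi$ for $\phi\in(-\pi,\pi]$, where $\operatorname{Arg}$ takes values in $(-\pi,\pi]$. $R_r^n$ denotes the $n$-fold composition of $R_r$ with itself. Derivatives of circle maps are derivatives of their lifts to $\mathbb{R}$. The caustic of a smooth circle map $f:S^1\to S^1$ is the envelope of the family of lines joining $\phi$ to $f(\phi)$; it is the curve parametrized, for $\phi$ with $1+f'(\phi)\neq0$, by $$x(\phi)=\frac{f'(\phi)\cos\phi+\cos f(\phi)}{1+f'(\phi)},\qquad y(\phi)=\frac{f'(\phi)\sin\phi+\sin f(\phi)}{1+f'(\phi)}.$$ The caustic has a (semicubical) cusp at $\phi$ if $x'(\phi)=y'(\phi)=0$ and $x''(\phi)y'''(\phi)-x'''(\phi)y''(\phi)\ne0$.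 *)

(* Defs.v *)
From Stdlib Require Import Reals Lra.
From Coquelicot Require Import Coquelicot.
Open Scope R_scope.

Definition circle : Type := {p : R * R | fst p ^ 2 + snd p ^ 2 = 1}.

Definition xc (z : circle) : R := fst (proj1_sig z).
Definition yc (z : circle) : R := snd (proj1_sig z).

Lemma pt_proof (phi : R) :
  fst (cos phi, sin phi) ^ 2 + snd (cos phi, sin phi) ^ 2 = 1.
Proof. simpl; generalize (sin2_cos2 phi); unfold Rsqr; lra. Qed.

Definition pt (phi : R) : circle := exist _ (cos phi, sin phi) (pt_proof phi).

(* Argument of x + i y, with values in ]-PI, PI]; irrelevant at the origin. *)
Definition Arg (x y : R) : R :=
  if Rle_dec 0 y then acos (x / sqrt (x ^ 2 + y ^ 2))
  else - acos (x / sqrt (x ^ 2 + y ^ 2)).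

Lemma Arg_spec (x y : R) : (x, y) <> (0, 0) ->
  - PI < Arg x y <= PI /\
  x = sqrt (x ^ 2 + y ^ 2) * cos (Arg x y) /\
  y = sqrt (x ^ 2 + y ^ 2) * sin (Arg x y).
Proof.
intros Hxy.
assert (Hp : 0 < x ^ 2 + y ^ 2).
{ destruct (Req_dec x 0) as [Hx|Hx]; destruct (Req_dec y 0) as [Hy|Hy].
  - subst; now elim Hxy.
  - assert (0 < y ^ 2) by now apply pow2_gt_0.
    generalize (pow2_ge_0 x); lra.
  - assert (0 < x ^ 2) by now apply pow2_gt_0.
    generalize (pow2_ge_0 y); lra.
  - assert (0 < x ^ 2) by now apply pow2_gt_0.
    generalize (pow2_ge_0 y); lra. }
set (s := sqrt (x ^ 2 + y ^ 2)).
assert (Hs : 0 < s) by now apply sqrt_lt_R0.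
assert (Hss : s * s = x ^ 2 + y ^ 2) by (apply sqrt_sqrt; lra).
assert (Hc : (x / s) * (x / s) + (y / s) * (y / s) = 1).
{ apply Rmult_eq_reg_r with (s * s); [|nra].
  replace ((x / s * (x / s) + y / s * (y / s)) * (s * s))
    with (x ^ 2 + y ^ 2) by (field; lra). lra. }
assert (Hb : -1 <= x / s <= 1) by nra.
assert (Hsin : sin (acos (x / s)) = Rabs (y / s)).
{ rewrite sin_acos by exact Hb. rewrite <- sqrt_Rsqr_abs.
  f_equal; unfold Rsqr; lra. }
assert (Hcos : cos (acos (x / s)) = x / s) by now apply cos_acos.
generalize (acos_bound (x / s)); intros HB.
generalize PI_RGT_0; intros HPI.
unfold Arg; fold s; destruct (Rle_dec 0 y) as [Hy|Hy].
- rewrite Hcos, Hsin.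
  assert (0 <= y / s) by (apply Rmult_le_pos; [lra|left; now apply Rinv_0_lt_compat]).
  rewrite Rabs_pos_eq by assumption.
  repeat split; try lra; field; lra.
- rewrite cos_neg, sin_neg, Hcos, Hsin.
  assert (Hys : y / s < 0).
  { assert (0 < / s) by now apply Rinv_0_lt_compat. unfold Rdiv; nra. }
  rewrite Rabs_left by assumption.
  assert (acos (x / s) <> PI).
  { intros E; rewrite E, sin_PI, Rabs_left in Hsin by assumption; lra. }
  repeat split; try lra; field; lra.
Qed.

Definition alpha (r phi : R) : R := Arg (cos phi - r) (sin phi) - phi.

Definition reflection (r : R) (z : circle) : circle :=
  let phi := Arg (xc z) (yc z) in
  pt (phi + PI - 2 * alpha r phi).

(* With d = z - (r, 0) the incoming direction, d - 2 <d, z> z is the direction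
   of the ray reflected at z, which meets the circle again at reflection r z. *)
Lemma reflection_geometric (r : R) (z : circle) : 0 <= r < 1 ->
  let dx := xc z - r in
  let dy := yc z in
  let dz := dx * xc z + dy * yc z in
  exists t : R, 0 < t /\
    xc (reflection r z) = xc z + t * (dx - 2 * dz * xc z) /\
    yc (reflection r z) = yc z + t * (dy - 2 * dz * yc z).
Proof.
destruct z as [[u v] Huv]; unfold reflection, alpha, xc, yc; simpl in *.
intros Hr.
assert (Hu : -1 <= u <= 1) by nra.
destruct (Arg_spec u v) as [_ [Hcu Hsv]].
{ intros E; injection E; intros; subst; lra. }
replace (u ^ 2 + v ^ 2) with 1 in * by (simpl; lra).
rewrite sqrt_1, Rmult_1_l in Hcu, Hsv.
set (f := Arg u v) in *.
rewrite <- Hcu, <- Hsv.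
assert (Hp : 0 < (u - r) ^ 2 + v ^ 2) by nra.
destruct (Arg_spec (u - r) v) as [_ [Hc Hs]].
{ intros E; injection E; intros E1 E2; rewrite E1, E2 in Hp; lra. }
set (p := Arg (u - r) v) in *.
set (s := sqrt ((u - r) ^ 2 + v ^ 2)) in *.
assert (Hs0 : 0 < s) by now apply sqrt_lt_R0.
assert (Hss : s * s = (u - r) ^ 2 + v ^ 2) by (apply sqrt_sqrt; lra).
exists (2 * (1 - r * u) / (s * s)).
split.
{ apply Rdiv_lt_0_compat; nra. }
assert (Hcp : cos p = (u - r) / s) by (rewrite Hc; field; lra).
assert (Hsp : sin p = v / s) by (rewrite Hs; field; lra).
replace (f + PI - 2 * (p - f)) with (f + 2 * f - 2 * p + PI) by ring.
rewrite neg_cos, neg_sin, cos_minus, sin_minus, !cos_plus, !sin_plus,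
  !cos_2a, !sin_2a, <- Hcu, <- Hsv, Hcp, Hsp.
assert (Hv : v * v = 1 - u * u) by lra.
assert (Hs2 : s * s = 1 - 2 * r * u + r * r) by (rewrite Hss; simpl; lra).
assert (Hd : 1 - 2 * r * u + r * r <> 0) by (rewrite <- Hs2; nra).
assert (H1 : (u - r) / s * ((u - r) / s) - v / s * (v / s)
  = ((u - r) * (u - r) - v * v) / (s * s)) by (field; lra).
assert (H2 : 2 * (v / s) * ((u - r) / s) = 2 * v * (u - r) / (s * s))
  by (field; lra).
rewrite H1, H2, Hs2.
split; apply Rmult_eq_reg_r with (1 - 2 * r * u + r * r); try exact Hd;
  field_simplify; try exact Hd.
replace (v ^ 4) with ((1 - u * u) * (1 - u * u)) by (rewrite <- Hv; ring).
replace (v ^ 2) with (1 - u * u) by (rewrite <- Hv; ring).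
ring.
replace (v ^ 5) with (v * ((1 - u * u) * (1 - u * u))) by (rewrite <- Hv; ring).
replace (v ^ 3) with (v * (1 - u * u)) by (rewrite <- Hv; ring).
replace (v ^ 2) with (1 - u * u) by (rewrite <- Hv; ring).
ring.
Qed.

Definition smooth (F : R -> R) : Prop := forall (n : nat) (x : R), ex_derive_n F n x.

Definition smooth_lift (f : circle -> circle) (F : R -> R) : Prop :=
  smooth F /\ forall phi : R, f (pt phi) = pt (F phi).

Definition caustic_x (F : R -> R) (phi : R) : R :=
  (Derive F phi * cos phi + cos (F phi)) / (1 + Derive F phi).

Definition caustic_y (F : R -> R) (phi : R) : R :=
  (Derive F phi * sin phi + sin (F phi)) / (1 + Derive F phi).

(* Two smooth lifts of f differ by a constant multiple of 2 PI, so the choice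
   of F is immaterial. *)
Definition caustic_has_cusp (f : circle -> circle) (phi : R) : Prop :=
  exists F : R -> R,
    smooth_lift f F /\
    1 + Derive F phi <> 0 /\
    Derive (caustic_x F) phi = 0 /\
    Derive (caustic_y F) phi = 0 /\
    Derive_n (caustic_x F) 2 phi * Derive_n (caustic_y F) 3 phi
      - Derive_n (caustic_x F) 3 phi * Derive_n (caustic_y F) 2 phi <> 0.

(* Main.v *)
Require Import Defs.
From Stdlib Require Import Reals Lra Lia Eqdep_dec.
From Coquelicot Require Import Coquelicot.
Open Scope R_scope.

(* The lift F(phi) = phi + PI - 2 atan (r sin phi / (1 - r cos phi)) has
   F' = 2 - (1 - r^2) / (1 - 2 r cos phi + r^2), and 0 and PI are exchanged by the
   reflection.  At a point t with F'' = 0 and F(t) antipodal to t, the two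
   conditions x' = y' = 0 are automatic and x'' y''' - x''' y'' equals
   D^2 / (1 + F')^3 with D = 2 F''' - F' + F'^3.  Along compositions D obeys
   D(f o g) = D(f) g'^3 + f' D(g), and for the reflection itself
   D = 24 rho^2 / (1 - rho)^2 and F' = (1 - 3 rho) / (1 - rho), with rho = r at 0
   and rho = - r at PI.  For 0 < |rho| < 1/3 both are positive, hence so are the
   values for all iterates.  In general D and F' are rational functions of r, so
   D and 1 + F', being nonzero at r = 1/4, have only isolated zeros. *)

(** * Smooth functions *)

(** An inductive form of being [n] times differentiable: each derivative is exhibited as a function,
    so the closure properties below follow by induction on [n] without formulas for [Derive_n]. *)
Fixpoint class_C (n : nat) (f : R -> R) : Prop :=
  match n with
  | O => True
  | S n => exists g, (forall x, is_derive f x (g x)) /\ class_C n g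
  end.

Lemma class_C_ext (n : nat) (f g : R -> R) :
  (forall x, f x = g x) -> class_C n f -> class_C n g.
Proof.
destruct n as [|n]; simpl; [easy|].
intros E [h [Hf Hh]]; exists h; split; [|easy].
intros x; apply (is_derive_ext f); auto.
Qed.

Lemma class_C_S (n : nat) (f : R -> R) : class_C (S n) f -> class_C n f.
Proof.
revert f; induction n as [|n IH]; [easy|].
intros f [g [Hf Hg]]; exists g; auto.
Qed.

Lemma class_C_const (n : nat) (c : R) : class_C n (fun _ => c).
Proof.
revert c; induction n as [|n IH]; intros c; [easy|].
exists (fun _ => 0); split; auto.
intros x; apply is_derive_Reals, derivable_pt_lim_const.
Qed.

Lemma class_C_id (n : nat) : class_C n (fun x => x).
Proof.
destruct n as [|n]; [easy|].
exists (fun _ => 1); split; [|apply class_C_const].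
intros x; apply is_derive_Reals, derivable_pt_lim_id.
Qed.

Lemma class_C_plus (n : nat) (f g : R -> R) :
  class_C n f -> class_C n g -> class_C n (fun x => f x + g x).
Proof.
revert f g; induction n as [|n IH]; intros f g; [easy|].
intros [f1 [Hf Hf1]] [g1 [Hg Hg1]].
exists (fun x => f1 x + g1 x); split; auto.
intros x; exact (is_derive_plus f g x _ _ (Hf x) (Hg x)).
Qed.

(** The derivative contains [f] and [g] undifferentiated, so the induction also uses them one order
    lower, through [class_C_S]. *)
Lemma class_C_mult (n : nat) (f g : R -> R) :
  class_C n f -> class_C n g -> class_C n (fun x => f x * g x).
Proof.
revert f g; induction n as [|n IH]; intros f g; [easy|].
intros Cf Cg; generalize (class_C_S _ _ Cf) (class_C_S _ _ Cg).
destruct Cf as [f1 [Hf Hf1]]; destruct Cg as [g1 [Hg Hg1]].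
exists (fun x => f1 x * g x + f x * g1 x); split.
- intros x; exact (is_derive_mult f g x _ _ (Hf x) (Hg x) Rmult_comm).
- apply class_C_plus; auto.
Qed.

Lemma class_C_comp (n : nat) (f g : R -> R) :
  class_C n f -> class_C n g -> class_C n (fun x => f (g x)).
Proof.
revert f g; induction n as [|n IH]; intros f g; [easy|].
intros [f1 [Hf Hf1]] Cg; generalize (class_C_S _ _ Cg).
destruct Cg as [g1 [Hg Hg1]].
exists (fun x => g1 x * f1 (g x)); split.
- intros x; exact (is_derive_comp f g x _ _ (Hf (g x)) (Hg x)).
- apply class_C_mult; auto.
Qed.

(** The derivative is written as a product in [/ f], to which the induction hypothesis applies. *)
Lemma class_C_inv (n : nat) (f : R -> R) :
  (forall x, f x <> 0) -> class_C n f -> class_C n (fun x => / f x).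
Proof.
intros Hf0; induction n as [|n IH]; [easy|].
intros Cf; generalize (class_C_S _ _ Cf).
destruct Cf as [f1 [Hf Hf1]]; intros Cf.
exists (fun x => -1 * (f1 x * (/ f x * / f x))); split.
- intros x.
  replace (-1 * (f1 x * (/ f x * / f x))) with (- f1 x / f x ^ 2)
    by (field; apply Hf0).
  apply is_derive_inv; auto.
- repeat apply class_C_mult; auto using class_C_const.
Qed.

Lemma class_C_sin_cos (n : nat) : class_C n sin /\ class_C n cos.
Proof.
induction n as [|n [IHs IHc]]; [easy|split].
- exists cos; split; [|easy].
  intros x; apply is_derive_Reals, derivable_pt_lim_sin.
- exists (fun x => -1 * sin x); split.
  + intros x; replace (-1 * sin x) with (- sin x) by ring.
    apply is_derive_Reals, derivable_pt_lim_cos.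
  + apply class_C_mult; auto using class_C_const.
Qed.

Lemma smooth_class_C (f : R -> R) : smooth f <-> forall n, class_C n f.
Proof.
split.
- intros Sf n.
  (* Generalised to all derivatives: the witness for the [k]-th one is the next one. *)
  assert (H : forall k, class_C n (Derive_n f k)).
  { induction n as [|n IH]; intros k; [easy|].
    exists (Derive_n f (S k)); split; [|easy].
    intros x; exact (Derive_correct _ _ (Sf (S k) x)). }
  exact (H O).
- intros Cf n; specialize (Cf n); revert f Cf.
  induction n as [|n IH]; intros f Cf x; [easy|].
  destruct Cf as [g [Hf Cg]].
  assert (E : forall k y, Derive_n f (S k) y = Derive_n g k y).
  { intros k y; replace (S k) with (k + 1)%nat by lia.
    rewrite <- Derive_n_comp; apply Derive_n_ext.
    intros z; apply is_derive_unique, Hf. }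
  destruct n as [|n]; [exists (g x); apply Hf|].
  apply (ex_derive_ext (Derive_n g n)); [now intros; rewrite E|].
  apply (IH g Cg x).
Qed.

Lemma smooth_ext (f g : R -> R) : (forall x, f x = g x) -> smooth f -> smooth g.
Proof.
rewrite !smooth_class_C; intros E Sf n; apply (class_C_ext n f); auto.
Qed.

Lemma smooth_id : smooth (fun x => x).
Proof. apply smooth_class_C; intros n; apply class_C_id. Qed.

Lemma smooth_plus (f g : R -> R) :
  smooth f -> smooth g -> smooth (fun x => f x + g x).
Proof. rewrite !smooth_class_C; auto using class_C_plus. Qed.

Lemma smooth_const (c : R) : smooth (fun _ => c).
Proof. apply smooth_class_C; auto using class_C_const. Qed.

Lemma smooth_mult (f g : R -> R) :
  smooth f -> smooth g -> smooth (fun x => f x * g x).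
Proof. rewrite !smooth_class_C; auto using class_C_mult. Qed.

Lemma smooth_comp (f g : R -> R) :
  smooth f -> smooth g -> smooth (fun x => f (g x)).
Proof. rewrite !smooth_class_C; auto using class_C_comp. Qed.

Lemma smooth_inv (f : R -> R) :
  (forall x, f x <> 0) -> smooth f -> smooth (fun x => / f x).
Proof. rewrite !smooth_class_C; auto using class_C_inv. Qed.

Lemma smooth_sin : smooth sin.
Proof. apply smooth_class_C; intros n; apply class_C_sin_cos. Qed.

Lemma smooth_cos : smooth cos.
Proof. apply smooth_class_C; intros n; apply class_C_sin_cos. Qed.

(** Serves to deduce smoothness of the lift from its explicit derivative, in which [atan] no longer
    occurs. *)
Lemma smooth_primitive (f g : R -> R) :
  (forall x, is_derive f x (g x)) -> smooth g -> smooth f.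
Proof.
rewrite !smooth_class_C; intros Hf Sg [|n]; [easy|exists g; auto].
Qed.

Lemma smooth_is_derive (f : R -> R) (n : nat) (x : R) :
  smooth f -> is_derive (Derive_n f n) x (Derive_n f (S n) x).
Proof. intros Sf; exact (Derive_correct _ _ (Sf (S n) x)). Qed.

Lemma smooth_Derive_n (f : R -> R) (k : nat) : smooth f -> smooth (Derive_n f k).
Proof.
intros Sf n x; destruct n as [|n]; [easy|].
apply (ex_derive_ext (Derive_n f (n + k))).
- intros y; now rewrite Derive_n_comp.
- apply (Sf (S (n + k))).
Qed.

(** * Explicit derivatives up to order three *)

(** Raises the order of a derivative formula by one. A formula valid near [x] suffices, as for
    quotients, where it holds only off the zeros of the denominator. *)
Lemma Derive_n_S_loc (f g : R -> R) (n : nat) (x l : R) :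
  locally x (fun y => Derive_n f n y = g y) -> is_derive g x l ->
  Derive_n f (S n) x = l.
Proof.
intros E Hg; simpl; rewrite (Derive_ext_loc _ _ _ E).
now apply is_derive_unique.
Qed.

Lemma Derive_n_S_ext (f g : R -> R) (n : nat) (x l : R) :
  (forall y, Derive_n f n y = g y) -> is_derive g x l ->
  Derive_n f (S n) x = l.
Proof.
intros E; apply Derive_n_S_loc; now apply filter_forall.
Qed.

Lemma is_derive_eq (f : R -> R) (x l l' : R) :
  is_derive f x l' -> l' = l -> is_derive f x l.
Proof. now intros H <-. Qed.

Lemma Derive_n_comp_123 (f g : R -> R) (x : R) : smooth f -> smooth g ->
  let h y := f (g y) in
  Derive_n h 1 x = Derive_n f 1 (g x) * Derive_n g 1 x /\
  Derive_n h 2 x = Derive_n f 2 (g x) * Derive_n g 1 x ^ 2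
                   + Derive_n f 1 (g x) * Derive_n g 2 x /\
  Derive_n h 3 x = Derive_n f 3 (g x) * Derive_n g 1 x ^ 3
                   + 3 * Derive_n f 2 (g x) * Derive_n g 1 x * Derive_n g 2 x
                   + Derive_n f 1 (g x) * Derive_n g 3 x.
Proof.
intros Sf Sg h.
assert (Hc : forall k y, is_derive (fun z => Derive_n f k (g z)) y
               (Derive_n f (S k) (g y) * Derive_n g 1 y)).
{ intros k y; rewrite Rmult_comm.
  apply (is_derive_comp (Derive_n f k) g).
  - now apply smooth_is_derive.
  - now apply (smooth_is_derive g 0). }
assert (Hg : forall k y, is_derive (Derive_n g k) y (Derive_n g (S k) y)).
{ intros; now apply smooth_is_derive. }
assert (Hm : forall (u v : R -> R) (y u1 v1 : R), is_derive u y u1 -> is_derive v y v1 ->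
           is_derive (fun z : R => u z * v z) y (u1 * v y + u y * v1)).
{ intros u v y u1 v1 Hu Hv; exact (is_derive_mult u v y _ _ Hu Hv Rmult_comm). }
assert (E1 : forall y, Derive_n h 1 y = Derive_n f 1 (g y) * Derive_n g 1 y).
{ intros y; apply (Derive_n_S_ext h h 0); [easy|apply (Hc O)]. }
(* The square is written as a product so that [Hm] can differentiate it once more. *)
assert (E2 : forall y, Derive_n h 2 y =
   Derive_n f 2 (g y) * (Derive_n g 1 y * Derive_n g 1 y)
   + Derive_n f 1 (g y) * Derive_n g 2 y).
{ intros y; eapply (Derive_n_S_ext h _ 1); [exact E1|].
  eapply is_derive_eq; [apply Hm; [apply Hc|apply Hg]|cbv beta; ring]. }
split; [apply E1|split].
- rewrite E2; ring.
- eapply (Derive_n_S_ext h _ 2); [exact E2|].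
  eapply is_derive_eq.
  + apply (is_derive_plus (V := R_NormedModule)); apply Hm.
    * apply Hc.
    * apply Hm; apply Hg.
    * apply Hc.
    * apply Hg.
  + change plus with Rplus; cbv beta; ring.
Qed.

Lemma smooth_locally_neq_0 (f : R -> R) (x : R) :
  smooth f -> f x <> 0 -> locally x (fun y => f y <> 0).
Proof.
intros Sf Hx.
assert (C : continuous f x).
{ apply (ex_derive_continuous (V := R_NormedModule)), (Sf 1%nat x). }
apply (C (fun u => u <> 0)), open_neq, Hx.
Qed.

Lemma Derive_n_div_123 (f g : R -> R) (x : R) :
  smooth f -> smooth g -> g x <> 0 ->
  let h y := f y / g y in
  let f0 := f x in let f1 := Derive_n f 1 x in
  let f2 := Derive_n f 2 x in let f3 := Derive_n f 3 x in
  let g0 := g x in let g1 := Derive_n g 1 x in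
  let g2 := Derive_n g 2 x in let g3 := Derive_n g 3 x in
  Derive_n h 1 x = (f1 * g0 - f0 * g1) / g0 ^ 2 /\
  Derive_n h 2 x = ((f2 * g0 - f0 * g2) * g0 - 2 * g1 * (f1 * g0 - f0 * g1)) / g0 ^ 3 /\
  Derive_n h 3 x =
    f3 / g0 - 3 * f2 * g1 / g0 ^ 2 + 3 * f1 * (2 * g1 ^ 2 / g0 ^ 3 - g2 / g0 ^ 2)
    + f0 * (- g3 / g0 ^ 2 + 6 * g1 * g2 / g0 ^ 3 - 6 * g1 ^ 3 / g0 ^ 4).
Proof.
intros Sf Sg Hx h.
assert (Hf : forall k y, is_derive (Derive_n f k) y (Derive_n f (S k) y)).
{ intros; now apply smooth_is_derive. }
assert (Hg : forall k y, is_derive (Derive_n g k) y (Derive_n g (S k) y)).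
{ intros; now apply smooth_is_derive. }
change (forall k y, is_derive (fun y => Derive_n f k y) y (Derive_n f (S k) y)) in Hf.
assert (Hf0 := Hf O); assert (Hf1 := Hf 1%nat); assert (Hf2 := Hf 2%nat).
assert (Hg0 := Hg O); assert (Hg1 := Hg 1%nat); assert (Hg2 := Hg 2%nat).
clear Hf Hg.
generalize (smooth_locally_neq_0 g x Sg Hx); intros Hl.
change (Derive_n f 0) with f in *; change (Derive_n g 0) with g in *.
set (F1 := Derive_n f 1) in *; set (F2 := Derive_n f 2) in *; set (F3 := Derive_n f 3) in *.
set (G1 := Derive_n g 1) in *; set (G2 := Derive_n g 2) in *; set (G3 := Derive_n g 3) in *.
(* [auto_derive] leaves derivatives in this eta-expanded form; these equations turn them back into
   the named functions. *)
assert (Df0 : forall y, Derive (fun z : R => f z) y = F1 y) by reflexivity.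
assert (Df1 : forall y, Derive (fun z : R => F1 z) y = F2 y) by reflexivity.
assert (Df2 : forall y, Derive (fun z : R => F2 z) y = F3 y) by reflexivity.
assert (Dg0 : forall y, Derive (fun z : R => g z) y = G1 y) by reflexivity.
assert (Dg1 : forall y, Derive (fun z : R => G1 z) y = G2 y) by reflexivity.
assert (Dg2 : forall y, Derive (fun z : R => G2 z) y = G3 y) by reflexivity.
assert (E1 : forall y, g y <> 0 -> Derive_n h 1 y = (F1 y * g y - f y * G1 y) / g y ^ 2).
{ intros y Hy; apply (Derive_n_S_ext h h 0); [easy|].
  apply is_derive_div; auto. }
assert (E2 : forall y, g y <> 0 -> Derive_n h 2 y =
   ((F2 y * g y - f y * G2 y) * g y - 2 * G1 y * (F1 y * g y - f y * G1 y)) / g y ^ 3).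
{ intros y Hy.
  apply (Derive_n_S_loc h (fun y => (F1 y * g y - f y * G1 y) / g y ^ 2) 1).
  - generalize (smooth_locally_neq_0 g y Sg Hy); apply filter_imp; intros z; apply E1.
  - auto_derive.
    + repeat split; try (eexists; now eauto).
      apply Rmult_integral_contrapositive_currified; lra.
    + rewrite (Df0 y), (Df1 y), (Dg0 y), (Dg1 y).
      field; auto. }
split; [now apply E1|split; [now apply E2|]].
apply (Derive_n_S_loc h (fun y =>
  ((F2 y * g y - f y * G2 y) * g y - 2 * G1 y * (F1 y * g y - f y * G1 y)) / g y ^ 3) 2).
- revert Hl; apply filter_imp; intros z; apply E2.
- auto_derive.
  + repeat split; try (eexists; now eauto).
    repeat apply Rmult_integral_contrapositive_currified; lra.
  + rewrite (Df0 x), (Df1 x), (Df2 x), (Dg0 x), (Dg1 x), (Dg2 x).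
    field; auto.
Qed.

Lemma Derive_n_plus_smooth (f g : R -> R) (n : nat) (x : R) : smooth f -> smooth g ->
  Derive_n (fun y => f y + g y) n x = Derive_n f n x + Derive_n g n x.
Proof.
intros Sf Sg; apply Derive_n_plus; apply filter_forall; intros; auto.
Qed.

Lemma Derive_n_mult_123 (f g : R -> R) (x : R) : smooth f -> smooth g ->
  let h y := f y * g y in
  Derive_n h 1 x = Derive_n f 1 x * g x + f x * Derive_n g 1 x /\
  Derive_n h 2 x = Derive_n f 2 x * g x + 2 * Derive_n f 1 x * Derive_n g 1 x
                   + f x * Derive_n g 2 x /\
  Derive_n h 3 x = Derive_n f 3 x * g x + 3 * Derive_n f 2 x * Derive_n g 1 x
                   + 3 * Derive_n f 1 x * Derive_n g 2 x + f x * Derive_n g 3 x.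
Proof.
intros Sf Sg h.
assert (Hm : forall i j y,
  is_derive (fun z => Derive_n f i z * Derive_n g j z) y
    (Derive_n f (S i) y * Derive_n g j y + Derive_n f i y * Derive_n g (S j) y)).
{ intros i j y; apply (is_derive_mult (Derive_n f i) (Derive_n g j)).
  - now apply smooth_is_derive.
  - now apply smooth_is_derive.
  - exact Rmult_comm. }
assert (E1 : forall y,
  Derive_n h 1 y = Derive_n f 1 y * Derive_n g 0 y + Derive_n f 0 y * Derive_n g 1 y).
{ intros y; apply (Derive_n_S_ext h h 0); [easy|apply (Hm O O)]. }
assert (E2 : forall y, Derive_n h 2 y =
   Derive_n f 2 y * Derive_n g 0 y + 2 * (Derive_n f 1 y * Derive_n g 1 y)
   + Derive_n f 0 y * Derive_n g 2 y).
{ intros y; eapply (Derive_n_S_ext h _ 1); [exact E1|].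
  eapply is_derive_eq.
  - apply (is_derive_plus (V := R_NormedModule)); apply Hm.
  - change plus with Rplus; cbv beta; ring. }
split; [apply E1|split].
- rewrite E2; change (Derive_n f 0 x) with (f x); change (Derive_n g 0 x) with (g x).
  ring.
- eapply (Derive_n_S_ext h _ 2); [exact E2|].
  eapply is_derive_eq.
  + apply (is_derive_plus (V := R_NormedModule)); [|apply Hm].
    apply (is_derive_plus (V := R_NormedModule)); [apply Hm|].
    apply (is_derive_scal (fun y => Derive_n f 1 y * Derive_n g 1 y)); apply Hm.
  + change plus with Rplus; cbv beta; change (Derive_n f 0 x) with (f x);
    change (Derive_n g 0 x) with (g x); ring.
Qed.

Lemma Derive_n_sin_cos_123 (x : R) :
  (Derive_n sin 1 x = cos x /\ Derive_n sin 2 x = - sin x /\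
   Derive_n sin 3 x = - cos x) /\
  (Derive_n cos 1 x = - sin x /\ Derive_n cos 2 x = - cos x /\
   Derive_n cos 3 x = sin x).
Proof.
assert (Hs : forall y, is_derive sin y (cos y)) by (intros; auto_derive; auto; ring).
assert (Hc : forall y, is_derive cos y (- sin y)) by (intros; auto_derive; auto; ring).
assert (Hns : forall y, is_derive (fun z => - sin z) y (- cos y))
  by (intros; auto_derive; auto; ring).
assert (Hnc : forall y, is_derive (fun z => - cos z) y (sin y))
  by (intros; auto_derive; auto; ring).
assert (S1 : forall y, Derive_n sin 1 y = cos y)
  by (intros; apply (Derive_n_S_ext sin sin 0); auto).
assert (S2 : forall y, Derive_n sin 2 y = - sin y)
  by (intros; apply (Derive_n_S_ext sin cos 1); auto).
assert (C1 : forall y, Derive_n cos 1 y = - sin y)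
  by (intros; apply (Derive_n_S_ext cos cos 0); auto).
assert (C2 : forall y, Derive_n cos 2 y = - cos y)
  by (intros; apply (Derive_n_S_ext cos (fun z => - sin z) 1); auto).
repeat split; auto.
- now apply (Derive_n_S_ext sin (fun z => - sin z) 2).
- now apply (Derive_n_S_ext cos (fun z => - cos z) 2).
Qed.

(** * Cusps of the caustic of a symmetric map *)

(* Up to the factor [2 F'] this is the projective Schwarzian derivative of F at
   a point where [F'' = 0]; unlike the latter it makes sense when [F' = 0]. *)
Definition defect (F : R -> R) (t : R) : R :=
  2 * Derive_n F 3 t - Derive_n F 1 t + Derive_n F 1 t ^ 3.

(** Write [a] for F'(t), [e] for cos t and D for the defect. The antipodal condition gives x' = y' =
    0, y'' = 0, x'' = e D / (1 + a)^2 and y''' = e D / (1 + a), and e^2 = 1. *)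
Lemma caustic_has_cusp_antipodal (f : circle -> circle) (F : R -> R) (t : R) :
  smooth_lift f F -> sin t = 0 -> cos (F t) = - cos t -> sin (F t) = 0 ->
  Derive_n F 2 t = 0 -> 1 + Derive_n F 1 t <> 0 -> defect F t <> 0 ->
  caustic_has_cusp f t.
Proof.
intros HF Hs HcF HsF H2 H1 Hd.
exists F; split; [exact HF|split; [exact H1|]].
destruct HF as [SF _]; unfold defect in Hd.
assert (Hc : cos t * cos t = 1) by (generalize (sin2_cos2 t); unfold Rsqr; nra).
set (w := fun y => 1 + Derive F y).
assert (Sw : smooth w).
{ apply smooth_plus; [apply smooth_const|now apply (smooth_Derive_n F 1)]. }
assert (Hw : forall k, Derive_n w (S k) t = Derive_n F (S (S k)) t).
{ intros k; unfold w.
  rewrite Derive_n_plus_smooth;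
    [|apply smooth_const|now apply (smooth_Derive_n F 1)].
  rewrite Derive_n_const, (Derive_n_comp F (S k) 1).
  replace (S k + 1)%nat with (S (S k)) by lia; ring. }
assert (SF1 : smooth (Derive_n F 1)) by now apply smooth_Derive_n.
assert (HF1 : forall k, Derive_n (Derive_n F 1) k t = Derive_n F (S k) t).
{ intros k; rewrite Derive_n_comp; f_equal; lia. }
(* Both numerators have the form F' u + u(F), with [u] the cosine or the sine; the formulas already
   use F''(t) = 0. *)
assert (HN : forall u, smooth u ->
  let N y := Derive F y * u y + u (F y) in
  smooth N /\
  Derive_n N 1 t = Derive_n F 1 t * (Derive_n u 1 t + Derive_n u 1 (F t)) /\
  Derive_n N 2 t = Derive_n F 3 t * u t
    + Derive_n F 1 t * Derive_n u 2 t + Derive_n F 1 t ^ 2 * Derive_n u 2 (F t) /\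
  Derive_n N 3 t = Derive_n F 4 t * u t
    + 3 * Derive_n F 3 t * Derive_n u 1 t + Derive_n F 1 t * Derive_n u 3 t
    + Derive_n F 3 t * Derive_n u 1 (F t) + Derive_n F 1 t ^ 3 * Derive_n u 3 (F t)).
{ intros u Su N.
  assert (Sm : smooth (fun y => Derive F y * u y)) by (now apply smooth_mult).
  assert (Sc : smooth (fun y => u (F y))) by (now apply smooth_comp).
  split; [now apply smooth_plus|].
  destruct (Derive_n_mult_123 (Derive_n F 1) u t SF1 Su) as [M1 [M2 M3]].
  destruct (Derive_n_comp_123 u F t Su SF) as [C1 [C2 C3]].
  unfold N; rewrite !(Derive_n_plus_smooth _ _ _ _ Sm Sc).
  rewrite C1, C2, C3.
  change (fun y => Derive F y * u y) with (fun y => Derive_n F 1 y * u y).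
  rewrite M1, M2, M3, !HF1, H2; repeat split; ring. }
destruct (HN cos smooth_cos) as [SX [X1 [X2 X3]]].
destruct (HN sin smooth_sin) as [SY [Y1 [Y2 Y3]]].
destruct (Derive_n_sin_cos_123 t) as [[s1 [s2 s3]] [c1 [c2 c3]]].
destruct (Derive_n_sin_cos_123 (F t)) as [[s1' [s2' s3']] [c1' [c2' c3']]].
rewrite s1, s1' in Y1; rewrite s2, s2' in Y2; rewrite s1, s1', s3, s3' in Y3.
(* The third derivative of the first coordinate is never computed: it is multiplied by y'' = 0. *)
rewrite c1, c1' in X1; rewrite c2, c2' in X2; clear X3.
destruct (Derive_n_div_123 _ w t SX Sw H1) as [x1 [x2 _]].
destruct (Derive_n_div_123 _ w t SY Sw H1) as [y1 [y2 y3]].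
rewrite X1, !Hw in x1; rewrite X1, X2, !Hw in x2.
rewrite Y1, !Hw in y1; rewrite Y1, Y2, !Hw in y2; rewrite Y1, Y2, Y3, !Hw in y3.
change (Derive (caustic_x F) t) with (Derive_n (caustic_x F) 1 t).
change (Derive (caustic_y F) t) with (Derive_n (caustic_y F) 1 t).
unfold caustic_x, caustic_y; fold (w t).
change (fun phi => (Derive F phi * cos phi + cos (F phi)) / (1 + Derive F phi))
  with (fun phi => (Derive F phi * cos phi + cos (F phi)) / w phi).
change (fun phi => (Derive F phi * sin phi + sin (F phi)) / (1 + Derive F phi))
  with (fun phi => (Derive F phi * sin phi + sin (F phi)) / w phi).
rewrite x1, x2, y1, y2, y3; clear - Hs HcF HsF H2 H1 Hd Hc.
change (w t) with (1 + Derive_n F 1 t); change (Derive F t) with (Derive_n F 1 t).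
rewrite Hs, HsF, HcF, H2.
set (a := Derive_n F 1 t) in *; set (b := Derive_n F 3 t) in *.
set (e := cos t) in *; clearbody a b e.
split; [field; exact H1|split; [field; exact H1|]].
match goal with |- ?u <> 0 => replace u with (e * e * (2 * b - a + a ^ 3) ^ 2 / (1 + a) ^ 3) end.
2: field; exact H1.
rewrite Hc; apply Rmult_integral_contrapositive_currified.
- rewrite Rmult_1_l; now apply pow_nonzero.
- now apply Rinv_neq_0_compat, pow_nonzero.
Qed.

(** In the third derivative the mixed term 3 f'' g' g'' vanishes, and the two terms f' g'^3 on the
    right cancel. *)
Lemma defect_comp (f g : R -> R) (t : R) : smooth f -> smooth g ->
  Derive_n f 2 (g t) = 0 -> Derive_n g 2 t = 0 ->
  let h y := f (g y) in
  Derive_n h 1 t = Derive_n f 1 (g t) * Derive_n g 1 t /\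
  Derive_n h 2 t = 0 /\
  defect h t = defect f (g t) * Derive_n g 1 t ^ 3 + Derive_n f 1 (g t) * defect g t.
Proof.
intros Sf Sg Hf Hg h; unfold defect.
destruct (Derive_n_comp_123 f g t Sf Sg) as [E1 [E2 E3]].
unfold h; rewrite E1, E2, E3, Hf, Hg; repeat split; ring.
Qed.

(** * The lift of the reflection *)

(** The quotient is the tangent of [alpha r phi]. Its denominator is positive for 0 < r < 1, so
    [atan] gives a smooth branch, unlike the jumping [Arg]. *)
Definition lift (r phi : R) : R :=
  phi + PI - 2 * atan (r * sin phi / (1 - r * cos phi)).

(** The slope fixes [x] only modulo PI, hence fixes 2 x modulo 2 PI. Only twice the angle enters the
    reflection, so comparing slopes is enough. *)
Lemma double_angle_of_slope (u x : R) : sin x = u * cos x ->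
  cos (2 * x) = (1 - u ^ 2) / (1 + u ^ 2) /\ sin (2 * x) = 2 * u / (1 + u ^ 2).
Proof.
intros H; generalize (sin2_cos2 x); unfold Rsqr; rewrite H; intros E.
assert (Hu : 0 < 1 + u ^ 2) by nra.
assert (Hk : cos x * cos x = / (1 + u ^ 2)).
{ apply Rmult_eq_reg_r with (1 + u ^ 2); [|lra].
  rewrite Rinv_l; lra. }
rewrite cos_2a, sin_2a, H; unfold Rdiv; rewrite <- Hk; split; ring.
Qed.

(** The proof components agree because equality on the reals is decidable, which makes its proofs
    unique. *)
Lemma circle_eq (z w : circle) : xc z = xc w -> yc z = yc w -> z = w.
Proof.
destruct z as [[x y] H], w as [[x' y'] H']; unfold xc, yc; simpl.
intros <- <-; f_equal; apply UIP_dec, Req_EM_T.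
Qed.

Lemma pt_eq (x y : R) : cos x = cos y -> sin x = sin y -> pt x = pt y.
Proof. now intros; apply circle_eq. Qed.

Lemma reflection_pt (r phi : R) : 0 < r < 1 ->
  reflection r (pt phi) = pt (lift r phi).
Proof.
intros Hr; unfold reflection, alpha, lift, xc, yc; simpl.
generalize (sin2_cos2 phi); unfold Rsqr; intros E.
destruct (Arg_spec (cos phi) (sin phi)) as [_ [Hc Hs]].
{ intros E0; injection E0; intros E1 E2; rewrite E1, E2 in E; lra. }
replace (cos phi ^ 2 + sin phi ^ 2) with 1 in Hc, Hs by (simpl; lra).
rewrite sqrt_1, Rmult_1_l in Hc, Hs.
set (q := Arg (cos phi) (sin phi)) in *.
rewrite <- Hc, <- Hs.
assert (Hb := COS_bound phi).
assert (Hp : 0 < (cos phi - r) ^ 2 + sin phi ^ 2) by nra.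
destruct (Arg_spec (cos phi - r) (sin phi)) as [_ [Kc Ks]].
{ intros E0; injection E0; intros E1 E2; rewrite E1, E2 in Hp; lra. }
set (p := Arg (cos phi - r) (sin phi)) in *.
set (s := sqrt ((cos phi - r) ^ 2 + sin phi ^ 2)) in *.
assert (Hs0 : 0 < s) by now apply sqrt_lt_R0.
assert (Hden : 0 < 1 - r * cos phi) by nra.
set (u := r * sin phi / (1 - r * cos phi)).
(* Multiplying by [s] turns cos p and sin p into the Cartesian coordinates of the incoming
   direction, which leaves an identity in cos phi and sin phi. *)
assert (HA : sin (p - q) = u * cos (p - q)).
{ apply Rmult_eq_reg_l with (s * (1 - r * cos phi)); [|nra].
  replace (s * (1 - r * cos phi) * (u * cos (p - q)))
    with (r * sin phi * (s * cos (p - q))) by (unfold u; field; lra).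
  rewrite sin_minus, cos_minus, <- Hc, <- Hs.
  replace (s * (1 - r * cos phi) * (sin p * cos phi - cos p * sin phi))
    with ((1 - r * cos phi) * (s * sin p * cos phi - s * cos p * sin phi)) by ring.
  replace (r * sin phi * (s * (cos p * cos phi + sin p * sin phi)))
    with (r * sin phi * (s * cos p * cos phi + s * sin p * sin phi)) by ring.
  rewrite <- Kc, <- Ks.
  replace (sin phi * sin phi) with (1 - cos phi * cos phi) by lra.
  ring_simplify.
  replace (sin phi ^ 3) with (sin phi * (1 - cos phi * cos phi))
    by (rewrite <- E; ring); ring. }
assert (HB : sin (atan u) = u * cos (atan u)).
{ assert (C := cos_atan u); assert (D := sin_atan u).
  rewrite C, D; unfold Rdiv; ring. }
destruct (double_angle_of_slope _ _ HA) as [A1 A2].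
destruct (double_angle_of_slope _ _ HB) as [B1 B2].
apply pt_eq.
- replace (q + PI - 2 * (p - q)) with (q - 2 * (p - q) + PI) by ring.
  replace (phi + PI - 2 * atan u) with (phi - 2 * atan u + PI) by ring.
  now rewrite !neg_cos, !cos_minus, A1, A2, B1, B2, <- Hc, <- Hs.
- replace (q + PI - 2 * (p - q)) with (q - 2 * (p - q) + PI) by ring.
  replace (phi + PI - 2 * atan u) with (phi - 2 * atan u + PI) by ring.
  now rewrite !neg_sin, !sin_minus, A1, A2, B1, B2, <- Hc, <- Hs.
Qed.

Lemma is_derive_lift (r phi : R) : 0 < r < 1 ->
  is_derive (lift r) phi (2 - (1 - r ^ 2) / (1 - 2 * r * cos phi + r ^ 2)).
Proof.
intros Hr; unfold lift.
assert (Hb := COS_bound phi).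
assert (Hden : 0 < 1 - r * cos phi) by nra.
assert (H0 : 0 < 1 - 2 * r * cos phi + r ^ 2) by nra.
generalize (sin2_cos2 phi); unfold Rsqr; intros E.
assert (E2 : sin phi ^ 2 = 1 - cos phi ^ 2) by (simpl; lra).
auto_derive; [lra|].
set (d := 1 - r * cos phi) in *.
(* Both sides are the squared distance from (r, 0) to the point of the circle at angle [phi]. *)
assert (Hd : d ^ 2 + r ^ 2 * sin phi ^ 2 = 1 - 2 * r * cos phi + r ^ 2).
{ rewrite E2; unfold d; ring. }
transitivity (1 - 2 * (r * cos phi * d - r ^ 2 * sin phi ^ 2)
                  / (d ^ 2 + r ^ 2 * sin phi ^ 2)).
- unfold d in *; field; lra.
- rewrite Hd, E2; unfold d; field; lra.
Qed.

Lemma lift_smooth (r : R) : 0 < r < 1 -> smooth (lift r).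
Proof.
intros Hr; apply (smooth_primitive _ _ (fun x => is_derive_lift r x Hr)).
apply smooth_ext with (fun x =>
  2 + -1 * ((1 - r ^ 2) * / (1 + (-2 * r * cos x + r ^ 2)))).
{ intros x; unfold Rminus, Rdiv; replace (1 + (-2 * r * cos x + r ^ 2))
    with (1 + - (2 * r * cos x) + r ^ 2) by ring; ring. }
apply smooth_plus; [apply smooth_const|].
apply smooth_mult; [apply smooth_const|].
apply smooth_mult; [apply smooth_const|].
apply smooth_inv.
{ intros x; assert (Hb := COS_bound x); nra. }
apply smooth_plus; [apply smooth_const|].
apply smooth_plus; [|apply smooth_const].
apply smooth_mult; [apply smooth_const|exact smooth_cos].
Qed.

(** The parameter [rho] stands for [r * cos t] with sin t = 0, so one formula serves both points and
    passing to the antipode is a change of sign. *)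
Definition slope1 (rho : R) : R := (1 - 3 * rho) / (1 - rho).
Definition defect1 (rho : R) : R := 24 * rho ^ 2 / (1 - rho) ^ 2.

Lemma sin_0_cos (t : R) : sin t = 0 -> cos t = 1 \/ cos t = -1.
Proof.
intros Hs; generalize (sin2_cos2 t); unfold Rsqr; rewrite Hs; intros E.
assert (H : (cos t - 1) * (cos t + 1) = 0) by lra.
apply Rmult_integral in H; lra.
Qed.

Lemma Derive_n_lift (r t : R) : 0 < r < 1 -> sin t = 0 ->
  Derive_n (lift r) 1 t = slope1 (r * cos t) /\
  Derive_n (lift r) 2 t = 0 /\
  defect (lift r) t = defect1 (r * cos t).
Proof.
intros Hr Hs; unfold defect.
assert (H0 : forall y, 0 < 1 - 2 * r * cos y + r ^ 2).
{ intros y; assert (Hb := COS_bound y); nra. }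
assert (E1 : forall y, Derive_n (lift r) 1 y
                       = 2 - (1 - r ^ 2) / (1 - 2 * r * cos y + r ^ 2)).
{ intros y; apply (Derive_n_S_ext _ (lift r) 0); [easy|now apply is_derive_lift]. }
assert (E2 : forall y, Derive_n (lift r) 2 y
   = (1 - r ^ 2) * (2 * r * sin y) / (1 - 2 * r * cos y + r ^ 2) ^ 2).
{ intros y; eapply (Derive_n_S_ext _ _ 1); [exact E1|].
  generalize (H0 y); intros Hy.
  auto_derive; [lra|field; lra]. }
(* Only the value at [t] is needed here; sin t = 0 removes the other term of the quotient rule. *)
assert (E3 : Derive_n (lift r) 3 t
   = (1 - r ^ 2) * (2 * r * cos t) / (1 - 2 * r * cos t + r ^ 2) ^ 2).
{ eapply (Derive_n_S_ext _ _ 2); [exact E2|].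
  generalize (H0 t); intros Ht.
  auto_derive; [apply Rgt_not_eq; apply Rmult_lt_0_compat; lra|].
  rewrite Hs; field; lra. }
rewrite E1, E2, E3, Hs; unfold slope1, defect1.
destruct (sin_0_cos t Hs) as [-> | ->].
- replace (1 - 2 * r * 1 + r ^ 2) with ((1 - r) ^ 2) by ring.
  repeat split; field; lra.
- replace (1 - 2 * r * -1 + r ^ 2) with ((1 + r) ^ 2) by ring.
  repeat split; field; lra.
Qed.

(** * Iterates of the lift at 0 and PI *)

(** The chain rule with the innermost reflection split off: it moves [t] to [t + PI], so the
    remaining [n] steps see [- rho]. *)
Fixpoint slope (n : nat) (rho : R) : R :=
  match n with
  | O => 1
  | S n => slope n (- rho) * slope1 rho
  end.

(** The recursion of [defect_comp] along the same orbit, starting from the identity, whose defect is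
    0. *)
Fixpoint defect_iter (n : nat) (rho : R) : R :=
  match n with
  | O => 0
  | S n => defect_iter n (- rho) * slope1 rho ^ 3 + slope n (- rho) * defect1 rho
  end.

Lemma smooth_lift_iter (n : nat) (r : R) : 0 < r < 1 ->
  smooth_lift (Nat.iter n (reflection r)) (Nat.iter n (lift r)).
Proof.
intros Hr; induction n as [|n [IHs IHp]].
- split; [exact smooth_id|easy].
- split.
  + apply (smooth_comp (lift r)); [now apply lift_smooth|exact IHs].
  + intros phi.
    change (reflection r (Nat.iter n (reflection r) (pt phi))
            = pt (lift r (Nat.iter n (lift r) phi))).
    rewrite IHp; now apply reflection_pt.
Qed.

Lemma Derive_n_lift_iter (n : nat) (r t : R) : 0 < r < 1 -> sin t = 0 ->
  let F := Nat.iter n (lift r) in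
  F t = t + INR n * PI /\ Derive_n F 1 t = slope n (r * cos t) /\
  Derive_n F 2 t = 0 /\ defect F t = defect_iter n (r * cos t).
Proof.
intros Hr; revert t; induction n as [|n IH]; intros t Hs F.
- assert (D1 : forall y, Derive_n F 1 y = 1) by (intros; apply Derive_id).
  assert (D2 : forall y, Derive_n F 2 y = 0).
  { intros y; apply (Derive_n_S_ext _ (fun _ => 1) 1); [exact D1|].
    auto_derive; auto. }
  assert (D3 : Derive_n F 3 t = 0).
  { apply (Derive_n_S_ext _ (fun _ => 0) 2); [exact D2|].
    auto_derive; auto. }
  unfold defect; rewrite D1, D2, D3; unfold F; simpl; repeat split; ring.
- assert (Ht : lift r t = t + PI).
  { unfold lift; rewrite Hs.
    replace (r * 0 / (1 - r * cos t)) with 0 by (unfold Rdiv; ring).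
    rewrite atan_0; ring. }
  destruct (Derive_n_lift r t Hr Hs) as [L1 [L2 L3]].
  assert (Hs' : sin (lift r t) = 0) by (rewrite Ht, neg_sin, Hs; ring).
  destruct (IH (lift r t) Hs') as [I0 [I1 [I2 I3]]].
  rewrite Ht, neg_cos in I1, I3; rewrite <- Ht in I1, I3.
  replace (r * - cos t) with (- (r * cos t)) in I1, I3 by ring.
  (* [Nat.iter] adds the new factor outside; it is moved inside so that the induction hypothesis
     applies at [lift r t]. *)
  assert (EF : forall y, F y = Nat.iter n (lift r) (lift r y)).
  { intros y; unfold F; now rewrite Nat.iter_succ_r. }
  destruct (defect_comp (Nat.iter n (lift r)) (lift r) t
    (proj1 (smooth_lift_iter n r Hr)) (lift_smooth r Hr) I2 L2) as [C1 [C2 C3]].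
  unfold defect in C3 at 1 |- *.
  assert (ED : forall k, Derive_n F k t
                         = Derive_n (fun y => Nat.iter n (lift r) (lift r y)) k t).
  { intros k; now apply Derive_n_ext. }
  rewrite !ED, C3, C1, C2, EF, I0, I1, I3, L1, L3, Ht, S_INR.
  repeat split; ring.
Qed.

(** This is where the odd exponent enters: the image of [t] is its antipode. *)
Lemma cos_sin_odd_PI (m : nat) (t : R) :
  cos (t + INR (2 * m + 1) * PI) = - cos t /\ sin (t + INR (2 * m + 1) * PI) = - sin t.
Proof.
replace (t + INR (2 * m + 1) * PI) with (t + PI + 2 * INR m * PI)
  by (rewrite plus_INR, mult_INR; simpl; ring).
now rewrite cos_period, sin_period, neg_cos, neg_sin.
Qed.

Lemma caustic_has_cusp_iter (m : nat) (r t : R) : 0 < r < 1 -> sin t = 0 ->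
  1 + slope (2 * m + 1) (r * cos t) <> 0 -> defect_iter (2 * m + 1) (r * cos t) <> 0 ->
  caustic_has_cusp (Nat.iter (2 * m + 1) (reflection r)) t.
Proof.
intros Hr Hs H1 Hd.
destruct (Derive_n_lift_iter (2 * m + 1) r t Hr Hs) as [F0 [F1 [F2 F3]]].
destruct (cos_sin_odd_PI m t) as [Ec Es].
apply caustic_has_cusp_antipodal with (Nat.iter (2 * m + 1) (lift r)).
- now apply smooth_lift_iter.
- exact Hs.
- now rewrite F0.
- rewrite F0, Es, Hs; ring.
- exact F2.
- now rewrite F1.
- now rewrite F3.
Qed.

(** * Positivity for small offsets *)

(** The interval is symmetric, so it survives the sign changes, and every factor [slope1] is
    positive on it. *)
Lemma slope_pos (n : nat) (rho : R) : - (1 / 3) < rho < 1 / 3 -> 0 < slope n rho.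
Proof.
revert rho; induction n as [|n IH]; intros rho H; simpl; [lra|].
apply Rmult_lt_0_compat; [apply IH; lra|].
apply Rdiv_lt_0_compat; lra.
Qed.

Lemma defect_iter_pos (n : nat) (rho : R) : - (1 / 3) < rho < 1 / 3 -> rho <> 0 ->
  0 < defect_iter (S n) rho.
Proof.
intros H H0.
assert (P : forall rho, - (1 / 3) < rho < 1 / 3 -> rho <> 0 ->
          0 < slope1 rho /\ 0 < defect1 rho).
{ intros x Hx Hx0; split; apply Rdiv_lt_0_compat; try lra.
  - apply Rmult_lt_0_compat; [lra|now apply pow2_gt_0].
  - apply pow_lt; lra. }
(* Only a weak inequality holds for all [k], since [defect_iter 0] is 0; strictness comes from the
   summand with [defect1]. *)
assert (N : forall k rho, - (1 / 3) < rho < 1 / 3 -> rho <> 0 -> 0 <= defect_iter k rho).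
{ induction k as [|k IH]; intros x Hx Hx0; simpl; [lra|].
  destruct (P x Hx Hx0).
  assert (0 < slope k (- x)) by (apply slope_pos; lra).
  assert (0 <= defect_iter k (- x)) by (apply IH; lra).
  assert (0 < slope1 x ^ 3) by now apply pow_lt.
  simpl in *; nra. }
simpl; destruct (P rho H H0).
assert (0 < slope n (- rho)) by (apply slope_pos; lra).
assert (0 <= defect_iter n (- rho)) by (apply N; lra).
assert (0 < slope1 rho ^ 3) by now apply pow_lt.
simpl in *; nra.
Qed.

(** * Isolated zeros of rational functions *)

(* The polynomials of degree less than n, described through divided differences. *)
Fixpoint poly_size (n : nat) (f : R -> R) : Prop :=
  match n with
  | O => forall x, f x = 0
  | S n => forall s, exists g, poly_size n g /\ forall x, f x = f s + (x - s) * g x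
  end.

Lemma poly_size_ext (n : nat) (f g : R -> R) :
  (forall x, f x = g x) -> poly_size n f -> poly_size n g.
Proof.
destruct n as [|n]; simpl; intros E Hf; [intros x; now rewrite <- E|].
intros s; destruct (Hf s) as [h [Hh Eh]]; exists h; split; [easy|].
intros x; now rewrite <- !E.
Qed.

Lemma poly_size_S (n : nat) (f : R -> R) : poly_size n f -> poly_size (S n) f.
Proof.
revert f; induction n as [|n IH]; intros f Hf s.
- exists (fun _ => 0); split; [easy|intros x; rewrite !Hf; ring].
- destruct (Hf s) as [g [Hg E]]; exists g; auto.
Qed.

Lemma poly_size_le (n k : nat) (f : R -> R) :
  (n <= k)%nat -> poly_size n f -> poly_size k f.
Proof. induction 1; auto using poly_size_S. Qed.

Lemma poly_size_const (c : R) : poly_size 1 (fun _ => c).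
Proof. intros s; exists (fun _ => 0); split; [easy|intros; ring]. Qed.

Lemma poly_size_id : poly_size 2 (fun x => x).
Proof. intros s; exists (fun _ => 1); split; [apply poly_size_const|intros; ring]. Qed.

Lemma poly_size_plus (n : nat) (f g : R -> R) :
  poly_size n f -> poly_size n g -> poly_size n (fun x => f x + g x).
Proof.
revert f g; induction n as [|n IH]; intros f g Hf Hg.
- intros x; rewrite Hf, Hg; ring.
- intros s; destruct (Hf s) as [f' [Hf' Ef]]; destruct (Hg s) as [g' [Hg' Eg]].
  exists (fun x => f' x + g' x); split; [auto|].
  intros x; rewrite (Ef x), (Eg x); ring.
Qed.

Lemma poly_size_scal (n : nat) (c : R) (f : R -> R) :
  poly_size n f -> poly_size n (fun x => c * f x).
Proof.
revert f; induction n as [|n IH]; intros f Hf.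
- intros x; rewrite Hf; ring.
- intros s; destruct (Hf s) as [f' [Hf' Ef]].
  exists (fun x => c * f' x); split; [auto|].
  intros x; rewrite (Ef x); ring.
Qed.

(** Product rule for divided differences: f(x) g(x) - f(s) g(s) is (x - s) times f'(x) g(x) + f(s)
    g'(x), where f' and g' denote divided differences at [s]. *)
Lemma poly_size_mult (n k : nat) (f g : R -> R) :
  poly_size n f -> poly_size k g -> poly_size (n + k) (fun x => f x * g x).
Proof.
revert f; induction n as [|n IH]; intros f Hf Hg.
- apply (poly_size_le 0); [lia|]; intros x; rewrite Hf; ring.
- destruct k as [|k].
  { apply (poly_size_le 0); [lia|]; intros x; rewrite Hg; ring. }
  intros s; destruct (Hf s) as [f' [Hf' Ef]]; destruct (Hg s) as [g' [Hg' Eg]].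
  exists (fun x => f' x * g x + f s * g' x); split.
  + apply poly_size_plus; [auto|].
    apply (poly_size_le k); [lia|now apply poly_size_scal].
  + intros x; rewrite (Ef x) at 1; rewrite (Eg x) at 1; rewrite (Eg x); ring.
Qed.

Lemma poly_size_opp (n : nat) (f : R -> R) :
  poly_size n f -> poly_size n (fun x => f (- x)).
Proof.
revert f; induction n as [|n IH]; intros f Hf.
- intros x; apply Hf.
- intros s; destruct (Hf (- s)) as [g [Hg E]].
  exists (fun x => -1 * g (- x)); split; [now apply poly_size_scal, IH|].
  intros x; rewrite (E (- x)); ring.
Qed.

Lemma poly_size_continuous (n : nat) (f : R -> R) (s : R) :
  poly_size n f -> continuous f s.
Proof.
revert f; induction n as [|n IH]; intros f Hf.
- apply (continuous_ext (fun _ => 0)); [now intros; rewrite Hf|apply continuous_const].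
- destruct (Hf s) as [g [Hg E]].
  apply (continuous_ext (fun x => f s + (x - s) * g x)); [now intros; rewrite <- E|].
  apply (continuous_plus (V := R_NormedModule)); [apply continuous_const|].
  apply (continuous_mult (K := R_AbsRing)); [|now apply IH].
  apply (continuous_minus (V := R_NormedModule)); [apply continuous_id|apply continuous_const].
Qed.

(** If f(s) is nonzero, continuity concludes. Otherwise x - s factors out, and the quotient has
    smaller size and is still nonzero at [x0]. *)
Lemma poly_size_isolated (n : nat) (f : R -> R) (x0 s : R) :
  poly_size n f -> f x0 <> 0 -> locally' s (fun x => f x <> 0).
Proof.
revert f; induction n as [|n IH]; intros f Hf H0; [now elim H0|].
destruct (Req_dec (f s) 0) as [Hs|Hs].
- destruct (Hf s) as [g [Hg E]].
  assert (Hg0 : g x0 <> 0).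
  { intros Hg0; apply H0; rewrite E, Hs, Hg0; ring. }
  generalize (IH g Hg Hg0); apply (filter_imp (F := locally s)); intros x Hx Hxs.
  rewrite E, Hs, Rplus_0_l.
  apply Rmult_integral_contrapositive_currified; [lra|auto].
- generalize (poly_size_continuous _ _ s Hf (fun u => u <> 0) (open_neq 0 _ Hs)).
  apply (filter_imp (F := locally s)); auto.
Qed.

(** Only poles at 1 and -1 occur, so powers of 1 - x^2 serve as denominators; being even, they are
    preserved by x -> - x. Restricting to ]-1, 1[ avoids the values that division by zero assigns at
    the poles. *)
Definition rational (f : R -> R) : Prop :=
  exists k n P, poly_size n P /\
    forall x, -1 < x < 1 -> f x * (1 - x ^ 2) ^ k = P x.

Lemma poly_size_pow (k : nat) : exists n, poly_size n (fun x => (1 - x ^ 2) ^ k).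
Proof.
induction k as [|k [n IH]].
- exists 1%nat; exact (poly_size_const 1).
- exists (5 + n)%nat; simpl; apply (poly_size_mult 5 n); [|exact IH].
  apply (poly_size_ext _ (fun x => 1 + -1 * (x * x))); [intros; ring|].
  apply poly_size_plus; [apply (poly_size_le 1); [lia|apply poly_size_const]|].
  apply poly_size_scal, (poly_size_le 4); [lia|].
  apply (poly_size_mult 2 2); apply poly_size_id.
Qed.

Lemma rational_mult (f g : R -> R) :
  rational f -> rational g -> rational (fun x => f x * g x).
Proof.
intros [k [n [P [HP EP]]]] [l [p [Q [HQ EQ]]]].
exists (k + l)%nat, (n + p)%nat, (fun x => P x * Q x).
split; [now apply poly_size_mult|].
intros x Hx; rewrite <- EP, <- EQ, pow_add by easy; ring.
Qed.

Lemma rational_plus (f g : R -> R) :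
  rational f -> rational g -> rational (fun x => f x + g x).
Proof.
intros [k [n [P [HP EP]]]] [l [p [Q [HQ EQ]]]].
destruct (poly_size_pow k) as [a Ha]; destruct (poly_size_pow l) as [b Hb].
exists (k + l)%nat, (n + b + (p + a))%nat,
  (fun x => P x * (1 - x ^ 2) ^ l + Q x * (1 - x ^ 2) ^ k); split.
- apply poly_size_plus.
  + apply (poly_size_le (n + b)); [lia|now apply poly_size_mult].
  + apply (poly_size_le (p + a)); [lia|now apply poly_size_mult].
- intros x Hx; rewrite <- EP, <- EQ, pow_add by easy; ring.
Qed.

Lemma rational_const (c : R) : rational (fun _ => c).
Proof.
exists O, 1%nat, (fun _ => c); split; [apply poly_size_const|intros; simpl; ring].
Qed.

Lemma rational_opp (f : R -> R) : rational f -> rational (fun x => f (- x)).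
Proof.
intros [k [n [P [HP EP]]]]; exists k, n, (fun x => P (- x)).
split; [now apply poly_size_opp|].
intros x Hx; rewrite <- EP by lra; now replace ((- x) ^ 2) with (x ^ 2) by ring.
Qed.

(** On ]-1, 1[ the denominator does not vanish, so [f] has there the zeros of its polynomial
    numerator. *)
Lemma rational_isolated (f : R -> R) (x0 s : R) : rational f ->
  -1 < x0 < 1 -> f x0 <> 0 -> -1 < s < 1 -> locally' s (fun x => f x <> 0).
Proof.
intros [k [n [P [HP EP]]]] Hx0 H0 Hs.
assert (P0 : P x0 <> 0).
{ rewrite <- EP by easy.
  apply Rmult_integral_contrapositive_currified; [easy|apply pow_nonzero; nra]. }
assert (L : locally s (fun x => -1 < x < 1)).
{ apply (locally_interval _ s (-1) 1); simpl; try tauto; lra. }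
generalize (filter_and _ _ L (poly_size_isolated n P x0 s HP P0)).
apply (filter_imp (F := locally s)); intros x [Hx Hn] Hxs Hf.
apply (Hn Hxs); rewrite <- EP, Hf by easy; ring.
Qed.

Lemma rational_slope1 : rational slope1.
Proof.
(* The factor 1 - x of 1 - x^2 cancels the denominator and 1 + x remains. *)
exists 1%nat, 4%nat, (fun x => (1 + -3 * x) * (1 + x)); split.
- assert (H : forall c, poly_size 2 (fun x => 1 + c * x)).
  { intros c; apply poly_size_plus.
    - apply (poly_size_le 1); [lia|apply poly_size_const].
    - apply poly_size_scal, poly_size_id. }
  apply (poly_size_mult 2 2); [apply H|].
  apply (poly_size_ext _ (fun x => 1 + 1 * x)); [intros; ring|apply H].
- intros x Hx; unfold slope1; field; lra.
Qed.

Lemma rational_defect1 : rational defect1.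
Proof.
exists 2%nat, 8%nat, (fun x => 24 * ((x * x) * ((1 + x) * (1 + x)))); split.
- assert (H : poly_size 2 (fun x => 1 + x)).
  { apply poly_size_plus; [|apply poly_size_id].
    apply (poly_size_le 1); [lia|apply poly_size_const]. }
  apply poly_size_scal, (poly_size_mult 4 4); apply (poly_size_mult 2 2);
    auto using poly_size_id.
- intros x Hx; unfold defect1; field; lra.
Qed.

Lemma rational_slope (n : nat) : rational (slope n).
Proof.
induction n as [|n IH]; [exact (rational_const 1)|].
apply rational_mult; [exact (rational_opp _ IH)|exact rational_slope1].
Qed.

Lemma rational_defect_iter (n : nat) : rational (defect_iter n).
Proof.
induction n as [|n IH]; [exact (rational_const 0)|].
assert (H := rational_slope1).
apply rational_plus.
- apply rational_mult; [exact (rational_opp _ IH)|].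
  (* The cube unfolds to three factors followed by 1. *)
  do 3 (apply rational_mult; [exact H|]); exact (rational_const 1).
- apply rational_mult; [exact (rational_opp _ (rational_slope n))|].
  exact rational_defect1.
Qed.

(** * Cusps for small and for generic offsets *)

Theorem proposition4p3 (m : nat) :
  (forall r : R, 0 < r < 1 / 3 ->
     caustic_has_cusp (Nat.iter (2 * m + 1) (reflection r)) 0 /\
     caustic_has_cusp (Nat.iter (2 * m + 1) (reflection r)) PI)
  /\
  (exists E : R -> Prop,
     (forall s : R, E s -> 1 / 3 < s < 1) /\
     (forall s : R, 1 / 3 < s < 1 -> locally' s (fun t : R => ~ E t)) /\
     (forall r : R, 1 / 3 < r < 1 -> ~ E r ->
        caustic_has_cusp (Nat.iter (2 * m + 1) (reflection r)) 0 /\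
        caustic_has_cusp (Nat.iter (2 * m + 1) (reflection r)) PI)).
Proof.
(* One function gathers both nonvanishing conditions: [h r] governs the point 0 and [h (- r)] the
   point PI. *)
set (h := fun x => (1 + slope (2 * m + 1) x) * defect_iter (2 * m + 1) x).
assert (Hpos : forall x, - (1 / 3) < x < 1 / 3 -> x <> 0 -> h x <> 0).
{ intros x Hx Hx0; apply Rmult_integral_contrapositive_currified.
  - assert (H := slope_pos (2 * m + 1) x Hx); lra.
  - replace (2 * m + 1)%nat with (S (2 * m)) by lia.
    assert (H := defect_iter_pos (2 * m) x Hx Hx0); lra. }
assert (Hcusp : forall r, 0 < r < 1 -> h r * h (- r) <> 0 ->
  caustic_has_cusp (Nat.iter (2 * m + 1) (reflection r)) 0 /\
  caustic_has_cusp (Nat.iter (2 * m + 1) (reflection r)) PI).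
{ intros r Hr H.
  assert (Hh : forall t, h (r * cos t) <> 0 -> sin t = 0 ->
    caustic_has_cusp (Nat.iter (2 * m + 1) (reflection r)) t).
  { intros t Ht Hs; apply caustic_has_cusp_iter; auto;
      intros E; apply Ht; unfold h; rewrite E; ring. }
  split; apply Hh.
  - rewrite cos_0, Rmult_1_r; intros E; apply H; rewrite E; ring.
  - exact sin_0.
  - rewrite cos_PI; replace (r * -1) with (- r) by ring.
    intros E; apply H; rewrite E; ring.
  - exact sin_PI. }
assert (Rh : rational (fun x => h x * h (- x))).
{ assert (H : rational h).
  { apply rational_mult; [|apply rational_defect_iter].
    apply rational_plus; [apply rational_const|apply rational_slope]. }
  apply rational_mult; [exact H|now apply rational_opp]. }
split.
- intros r Hr; apply Hcusp; [lra|].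
  apply Rmult_integral_contrapositive_currified; apply Hpos; lra.
(* The exceptional values are the zeros of the product for the two points. *)
- exists (fun r => 1 / 3 < r < 1 /\ h r * h (- r) = 0).
  split; [tauto|split].
  + intros s Hs.
    assert (L : locally' s (fun x => h x * h (- x) <> 0)).
    { apply (rational_isolated _ (1 / 4) s Rh); try lra.
      apply Rmult_integral_contrapositive_currified; apply Hpos; lra. }
    revert L; apply filter_imp; tauto.
  + intros r Hr HE; apply Hcusp; [lra|tauto].
Qed.
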